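(* The Hasimoto transformation is the Madelung transform in the one-dimensional case. That is, let $\gamma\subset\mathbb{R}^3$ be a curve with arc-length parameter $x$, curvature $k(x)>0$ and torsion $\tau(x)$, and set $\rho=k^2$ and $\theta(x)=2\int_{x_0}^x\tau(\tilde x)\,d\tilde x$ (so that $v=\theta'=2\tau$). Then the Hasimoto wave function of $\gamma$ equals the Madelung transform of $(\rho,\theta)$: $$k(x)\,e^{i\int_{x_0}^x\tau(\tilde x)\,d\tilde x}=\sqrt{\rho(x)}\,e^{i\theta(x)/2}.$$
   Context: The Madelung transform associates to a pair of real functions $(\rho,\theta)$ with $\rho>0$ the complex-valued function $\psi=\sqrt{\rho e^{i\theta}}:=\sqrt{\rho}\,e^{i\theta/2}$; the associated fluid variables are the density $\rho$ and the velocity $v=\nabla\theta$. The Hasimoto transformation assigns to a curve $\gamma\subset\mathbb{R}^3$ with curvature $k$ and torsion $\tau$ the wave function $\psi(x)=k(x)e^{i\int_{x_0}^x\tau(\tilde x)\,d\tilde x}$, where $x_0$ is a fixed base point (changing it multiplies $\psi$ by a constant phase). *)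

(* Defs.v *)
From Stdlib Require Import Reals.
From Coquelicot Require Import Coquelicot.
Open Scope R_scope.

Definition open_itv (a b : Rbar) (x : R) : Prop := Rbar_lt a x /\ Rbar_lt x b.

Definition vec3 : Type := (R * R * R)%type.

Definition v1 (u : vec3) : R := fst (fst u).
Definition v2 (u : vec3) : R := snd (fst u).
Definition v3 (u : vec3) : R := snd u.

Definition dot3 (u w : vec3) : R := v1 u * v1 w + v2 u * v2 w + v3 u * v3 w.
Definition norm3 (u : vec3) : R := sqrt (dot3 u u).
Definition scal3 (c : R) (u : vec3) : vec3 := (c * v1 u, c * v2 u, c * v3 u).
Definition cross3 (u w : vec3) : vec3 :=
  (v2 u * v3 w - v3 u * v2 w,
   v3 u * v1 w - v1 u * v3 w,
   v1 u * v2 w - v2 u * v1 w).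

Definition Derive3 (f : R -> vec3) (t : R) : vec3 :=
  (Derive (fun s => v1 (f s)) t,
   Derive (fun s => v2 (f s)) t,
   Derive (fun s => v3 (f s)) t).

(* [Derive] is total, so differentiability at order [n] alone would not imply
   it at lower orders: every order up to [n] is required. *)
Definition Cn_on (n : nat) (I : R -> Prop) (f : R -> R) : Prop :=
  forall t, I t ->
    (forall j, (j <= n)%nat -> ex_derive_n f j t) /\
    continuous (Derive_n f n) t.

Definition Cn_curve_on (n : nat) (I : R -> Prop) (gamma : R -> vec3) : Prop :=
  Cn_on n I (fun t => v1 (gamma t)) /\
  Cn_on n I (fun t => v2 (gamma t)) /\
  Cn_on n I (fun t => v3 (gamma t)).

Definition arc_length_on (I : R -> Prop) (gamma : R -> vec3) : Prop :=
  forall t, I t -> norm3 (Derive3 gamma t) = 1.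

(* Frenet apparatus of a curve parametrized by arc length, with the sign
   convention B' = - tau N (right-handed helices have positive torsion). *)
Definition tangent (gamma : R -> vec3) (x : R) : vec3 := Derive3 gamma x.

Definition curvature (gamma : R -> vec3) (x : R) : R :=
  norm3 (Derive3 (tangent gamma) x).

Definition normal (gamma : R -> vec3) (x : R) : vec3 :=
  scal3 (/ curvature gamma x) (Derive3 (tangent gamma) x).

Definition binormal (gamma : R -> vec3) (x : R) : vec3 :=
  cross3 (tangent gamma x) (normal gamma x).

Definition torsion (gamma : R -> vec3) (x : R) : R :=
  - dot3 (Derive3 (binormal gamma) x) (normal gamma x).

Definition Cexp (z : C) : C :=
  (exp (Re z) * cos (Im z), exp (Re z) * sin (Im z)).

(* [RInt] is oriented, so [x < x0] is covered. *)
Definition hasimoto (x0 : R) (gamma : R -> vec3) (x : R) : C :=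
  (RtoC (curvature gamma x) *
   Cexp (Ci * RtoC (RInt (torsion gamma) x0 x)))%C.

Definition madelung {M : Type} (rho theta : M -> R) (x : M) : C :=
  (RtoC (sqrt (rho x)) * Cexp (Ci * RtoC (theta x) / RtoC 2))%C.

(* Main.v *)
Require Import Defs.
From Stdlib Require Import Reals Lra Lia.
From Coquelicot Require Import Coquelicot.
Open Scope R_scope.

(** With [rho = k ^ 2] and [theta] twice the torsion integral, the two wave
    functions have the same modulus, [sqrt (k ^ 2) = k] because [k > 0], and
    the same phase, since the half in the Madelung phase cancels the factor two
    in [theta].

    The analytic content is [theta' = 2 tau].  By the fundamental theorem of
    calculus it follows once the torsion is continuous on the interval
    ([continuous_torsion]).  For this, the tangent and the second derivative
    of a C^3 curve have C^1 components, and C^1 functions are closed under the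
    ring operations, under inverses of nonvanishing functions and under square
    roots of positive ones.  Where [k > 0], this makes [k], then the normal,
    then the binormal C^1, so that [tau = - B' . N] is continuous. *)

(** Naming a derivative [df], instead of using the total operator [Derive],
    lets the rules of calculus be applied pointwise: openness of [U] is needed
    only when returning to [Derive]. *)
Definition C1_on (U : R -> Prop) (f : R -> R) : Prop :=
  exists df : R -> R,
    forall t, U t -> is_derive f t (df t) /\ continuous df t.

Lemma is_derive_continuous (f : R -> R) (t l : R) :
  is_derive f t l -> continuous f t.
Proof.
  intros H. apply (ex_derive_continuous (V := R_NormedModule)).
  now exists l.
Qed.

Lemma C1_on_continuous (U : R -> Prop) (f : R -> R) (t : R) :
  C1_on U f -> U t -> continuous f t.
Proof.
  intros [df Hf] Ht. exact (is_derive_continuous f t _ (proj1 (Hf t Ht))).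
Qed.

Lemma C1_on_continuous_Derive (U : R -> Prop) (f : R -> R) (t : R) :
  C1_on U f -> locally t U -> continuous (Derive f) t.
Proof.
  intros [df Hf] Ht.
  apply continuous_ext_loc with df.
  - eapply filter_imp; [|exact Ht]. intros s Hs.
    symmetry. apply is_derive_unique. apply Hf, Hs.
  - apply Hf. exact (locally_singleton _ _ Ht).
Qed.

Lemma C1_on_plus (U : R -> Prop) (f g : R -> R) :
  C1_on U f -> C1_on U g -> C1_on U (fun t => f t + g t).
Proof.
  intros [df Hf] [dg Hg]. exists (fun t => df t + dg t). intros t Ht.
  destruct (Hf t Ht), (Hg t Ht). split.
  - now apply (is_derive_plus (V := R_NormedModule) f g).
  - now apply (continuous_plus (V := R_NormedModule) df dg).
Qed.

Lemma C1_on_minus (U : R -> Prop) (f g : R -> R) :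
  C1_on U f -> C1_on U g -> C1_on U (fun t => f t - g t).
Proof.
  intros [df Hf] [dg Hg]. exists (fun t => df t - dg t). intros t Ht.
  destruct (Hf t Ht), (Hg t Ht). split.
  - now apply (is_derive_minus (V := R_NormedModule) f g).
  - now apply (continuous_minus (V := R_NormedModule) df dg).
Qed.

Lemma continuous_Rmult (f g : R -> R) (t : R) :
  continuous f t -> continuous g t -> continuous (fun s => f s * g s) t.
Proof. exact (continuous_mult (K := R_AbsRing) f g t). Qed.

Lemma C1_on_mult (U : R -> Prop) (f g : R -> R) :
  C1_on U f -> C1_on U g -> C1_on U (fun t => f t * g t).
Proof.
  intros [df Hf] [dg Hg]. exists (fun t => df t * g t + f t * dg t).
  intros t Ht. destruct (Hf t Ht) as [Df Cf], (Hg t Ht) as [Dg Cg]. split.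
  - apply (is_derive_mult f g); trivial. intros n m. apply Rmult_comm.
  - apply (continuous_plus (V := R_NormedModule)); apply continuous_Rmult;
      trivial; eapply is_derive_continuous; eassumption.
Qed.

Lemma C1_on_inv (U : R -> Prop) (f : R -> R) :
  C1_on U f -> (forall t, U t -> f t <> 0) -> C1_on U (fun t => / f t).
Proof.
  intros [df Hf] Hnz. exists (fun t => - df t * (/ f t * / f t)).
  intros t Ht. destruct (Hf t Ht) as [Df Cf]. specialize (Hnz t Ht). split.
  - replace (- df t * (/ f t * / f t)) with (- df t / f t ^ 2)
      by now field.
    now apply is_derive_inv.
  - assert (continuous (fun s => / f s) t).
    { apply continuous_Rinv_comp; trivial.
      exact (is_derive_continuous f t _ Df). }
    apply continuous_Rmult.
    + now apply (continuous_opp (V := R_NormedModule) df).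
    + now apply continuous_Rmult.
Qed.

Lemma C1_on_sqrt (U : R -> Prop) (f : R -> R) :
  C1_on U f -> (forall t, U t -> 0 < f t) -> C1_on U (fun t => sqrt (f t)).
Proof.
  intros [df Hf] Hpos. exists (fun t => df t * / (2 * sqrt (f t))).
  intros t Ht. destruct (Hf t Ht) as [Df Cf]. specialize (Hpos t Ht). split.
  - apply (is_derive_comp sqrt f); trivial.
    apply is_derive_Reals. now apply derivable_pt_lim_sqrt.
  - apply continuous_Rmult; trivial.
    apply continuous_Rinv_comp.
    + apply continuous_Rmult; [apply continuous_const|].
      apply continuous_sqrt_comp. exact (is_derive_continuous f t _ Df).
    + pose proof (sqrt_lt_R0 _ Hpos). lra.
Qed.

(** Below the top order, continuity of the next derivative comes from its own
    differentiability. *)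
Lemma Cn_on_C1_Derive_n (n j : nat) (U : R -> Prop) (f : R -> R) :
  Cn_on n U f -> (j < n)%nat -> C1_on U (Derive_n f j).
Proof.
  intros Hf Hj. exists (Derive_n f (S j)). intros t Ht.
  destruct (Hf t Ht) as [Hd Hc]. split.
  - apply Derive_correct. exact (Hd (S j) Hj).
  - destruct (Nat.eq_dec (S j) n) as [->|Hne]; [exact Hc|].
    apply (ex_derive_continuous (V := R_NormedModule)).
    apply (Hd (S (S j))). lia.
Qed.

(** The normal is built from second derivatives of the curve, so for a C^3 curve
    it is C^1, as is the binormal; differentiating the binormal uses up the last
    order of differentiability and leaves [B' . N] continuous. *)
Lemma continuous_torsion (U : R -> Prop) (gamma : R -> vec3) (t : R) :
  Cn_curve_on 3 U gamma -> (forall s, U s -> 0 < curvature gamma s) ->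
  locally t U -> continuous (torsion gamma) t.
Proof.
  intros [H1 [H2 H3]] Hk Ht.
  pose (d j (c : vec3 -> R) := Derive_n (fun s => c (gamma s)) j).
  assert (T1 : C1_on U (d 1%nat v1)) by (eapply Cn_on_C1_Derive_n; eauto).
  assert (T2 : C1_on U (d 1%nat v2)) by (eapply Cn_on_C1_Derive_n; eauto).
  assert (T3 : C1_on U (d 1%nat v3)) by (eapply Cn_on_C1_Derive_n; eauto).
  assert (A1 : C1_on U (d 2%nat v1)) by (eapply Cn_on_C1_Derive_n; eauto).
  assert (A2 : C1_on U (d 2%nat v2)) by (eapply Cn_on_C1_Derive_n; eauto).
  assert (A3 : C1_on U (d 2%nat v3)) by (eapply Cn_on_C1_Derive_n; eauto).
  assert (K : C1_on U (curvature gamma)).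
  { apply C1_on_sqrt.
    - apply C1_on_plus; [apply C1_on_plus|]; now apply C1_on_mult.
    - intros s Hs. apply sqrt_lt_0_alt. rewrite sqrt_0. exact (Hk s Hs). }
  assert (IK : C1_on U (fun s => / curvature gamma s)).
  { apply C1_on_inv; trivial. intros s Hs. specialize (Hk s Hs). lra. }
  assert (N1 : C1_on U (fun s => v1 (normal gamma s)))
    by exact (C1_on_mult U _ _ IK A1).
  assert (N2 : C1_on U (fun s => v2 (normal gamma s)))
    by exact (C1_on_mult U _ _ IK A2).
  assert (N3 : C1_on U (fun s => v3 (normal gamma s)))
    by exact (C1_on_mult U _ _ IK A3).
  assert (B1 : C1_on U (fun s => v1 (binormal gamma s)))
    by (apply C1_on_minus; now apply C1_on_mult).
  assert (B2 : C1_on U (fun s => v2 (binormal gamma s)))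
    by (apply C1_on_minus; now apply C1_on_mult).
  assert (B3 : C1_on U (fun s => v3 (binormal gamma s)))
    by (apply C1_on_minus; now apply C1_on_mult).
  assert (Ut : U t) by exact (locally_singleton _ _ Ht).
  apply (continuous_opp (V := R_NormedModule)).
  apply (continuous_plus (V := R_NormedModule));
    [apply (continuous_plus (V := R_NormedModule))|];
    apply continuous_Rmult.
  - exact (C1_on_continuous_Derive U _ t B1 Ht).
  - exact (C1_on_continuous U _ t N1 Ut).
  - exact (C1_on_continuous_Derive U _ t B2 Ht).
  - exact (C1_on_continuous U _ t N2 Ut).
  - exact (C1_on_continuous_Derive U _ t B3 Ht).
  - exact (C1_on_continuous U _ t N3 Ut).
Qed.

Lemma locally_open_itv (a b : Rbar) (x : R) :
  open_itv a b x -> locally x (open_itv a b).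
Proof.
  apply (open_and (fun y : R => Rbar_lt a y) (fun y : R => Rbar_lt y b)
           (open_Rbar_gt a) (open_Rbar_lt b)).
Qed.

Lemma open_itv_between (a b : Rbar) (x y z : R) :
  open_itv a b x -> open_itv a b y -> Rmin x y <= z <= Rmax x y ->
  open_itv a b z.
Proof.
  intros [ax xb] [ay yb] [Hl Hr]. split.
  - apply Rbar_lt_le_trans with (Rmin x y); [|exact Hl].
    now apply (Rmin_case x y (fun r => Rbar_lt a r)).
  - apply Rbar_le_lt_trans with (Rmax x y); [exact Hr|].
    now apply (Rmax_case x y (fun r => Rbar_lt r b)).
Qed.

Lemma is_derive_RInt_open_itv (a b : Rbar) (f : R -> R) (x0 x : R) :
  (forall y, open_itv a b y -> continuous f y) ->
  open_itv a b x0 -> open_itv a b x ->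
  is_derive (RInt f x0) x (f x).
Proof.
  intros Hf Hx0 Hx.
  apply (is_derive_RInt (V := R_CompleteNormedModule) f (RInt f x0) x0 x);
    [|now apply Hf].
  eapply filter_imp; [|exact (locally_open_itv a b x Hx)]. intros y Hy.
  apply (RInt_correct (V := R_CompleteNormedModule)).
  apply (ex_RInt_continuous (V := R_CompleteNormedModule)).
  intros z Hz. apply Hf. exact (open_itv_between a b x0 y z Hx0 Hy Hz).
Qed.

Theorem proposition2p14 (a b : Rbar) (gamma : R -> vec3) (x0 : R)
  (rho theta : R -> R)
  (hx0 : open_itv a b x0)
  (hgamma : Cn_curve_on 3 (open_itv a b) gamma)
  (harc : arc_length_on (open_itv a b) gamma)
  (hk : forall x, open_itv a b x -> 0 < curvature gamma x)
  (hrho : forall x, open_itv a b x -> rho x = curvature gamma x ^ 2)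
  (htheta : forall x, open_itv a b x ->
     theta x = 2 * RInt (torsion gamma) x0 x) :
  forall x, open_itv a b x ->
    0 < rho x /\
    is_derive theta x (2 * torsion gamma x) /\
    hasimoto x0 gamma x = madelung rho theta x.
Proof.
  intros x Hx. pose proof (hk x Hx) as Hkx. split; [|split].
  - rewrite (hrho x Hx). now apply pow_lt.
  - apply (is_derive_ext_loc (fun y => 2 * RInt (torsion gamma) x0 y)).
    + eapply filter_imp; [|exact (locally_open_itv a b x Hx)]. intros y Hy.
      symmetry. exact (htheta y Hy).
    + apply is_derive_scal.
      apply (is_derive_RInt_open_itv a b); trivial.
      intros y Hy. apply (continuous_torsion (open_itv a b)); trivial.
      now apply locally_open_itv.
  - unfold hasimoto, madelung.
    rewrite (hrho x Hx), (htheta x Hx).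
    rewrite sqrt_pow2; [|lra].
    do 2 f_equal.
    rewrite RtoC_mult. field.
Qed.
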